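(* Let $\mathcal S$ be a set of solutions $(x,y,k)$ of $y^2=x^3+k$ (in integers $x\ge 1$, $y\ge 1$, $k\ne 0$), and for a real number $\kappa$ with $6/11\le\kappa<6/5$ put $\gamma(\kappa)=\frac{3}{\kappa}-\frac52$. (a) Let $6/11\le\kappa<6/5$. Assume that, for every $\varepsilon>0$, only finitely many solutions in $\mathcal S$ satisfy $G_a>\kappa+\varepsilon$. Then, for every $\delta\in(0,\gamma(\kappa))$, only finitely many solutions in $\mathcal S$ satisfy $|k|<x^{\gamma(\kappa)-\delta}$. (b) Let $3/4\le\kappa<6/5$. Conversely, assume that, for every $\delta\in(0,\gamma(\kappa))$, only finitely many solutions in $\mathcal S$ satisfy $|k|<x^{\gamma(\kappa)-\delta}$. Then, for every $\varepsilon>0$, only finitely many solutions in $\mathcal S$ satisfy $G_a>\kappa+\varepsilon$.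
   Context: A solution is a triple $(x,y,k)$ of integers with $y^2=x^3+k$, $x\ge 1$, $y\ge 1$ and $k\ne 0$. For a solution put $M=\max\{x^3,y^2\}$ and $P=xy|k|$ (one always has $P\ge 2$). The approximation gain of the solution is $G_a=\frac{\log M}{\log P}$. *)

(* Defs.v *)
From HB Require Import structures.
From mathcomp Require Import all_boot all_order all_algebra.
From mathcomp Require Import all_classical all_reals all_analysis.
Set Implicit Arguments.
Unset Strict Implicit.
Unset Printing Implicit Defensive.
Import Order.TTheory GRing.Theory Num.Theory.
Local Open Scope classical_set_scope.
Local Open Scope ring_scope.

Definition solutions : set (int * int * int) :=
  [set s : int * int * int | let: (x, y, k) := s in
    [/\ y ^+ 2 = x ^+ 3 + k, 1 <= x, 1 <= y & k != 0]].

Definition Mval (s : int * int * int) : int :=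
  let: (x, y, _) := s in Num.max (x ^+ 3) (y ^+ 2).

Definition Pval (s : int * int * int) : int :=
  let: (x, y, k) := s in x * y * `|k|.

Definition approx_gain (R : realType) (s : int * int * int) : R :=
  ln (Mval s)%:~R / ln (Pval s)%:~R.

Definition gamma (R : realType) (kappa : R) : R := 3 / kappa - 5 / 2.

Definition large_gain (R : realType) (S : set (int * int * int)) (c : R) :
    set (int * int * int) :=
  [set s | S s /\ c < approx_gain R s].

Definition small_k (R : realType) (S : set (int * int * int)) (e : R) :
    set (int * int * int) :=
  [set s | S s /\ let: (x, _, k) := s in `|k|%:~R < x%:~R `^ e].

(* Main.v *)
(* Let X, Y, K be the logarithms of x, y, |k|. If x^3 and y^2 are within a
   factor 2 of each other, then 2Y = 3X + O(1), so log M = 3X + O(1) and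
   log P = (5/2)X + K + O(1); hence G_a > c amounts, up to bounded errors, to
   K < (3/c - 5/2)X = gamma(c) X, and the errors are absorbed once X is large.
   For (a) only the upper bound on log P is needed, and |k| <= x^3 already
   yields y^2 <= 2x^3. For (b), if instead 2x^3 < y^2, then K >= 2Y - O(1) and
   G_a <= 2Y/(3Y - O(1)); if 2y^2 < x^3, then K >= 3X - O(1) and
   G_a <= 3X/(4X - O(1)). So for c > 3/4 a gain above c leaves only
   boundedly many unbalanced solutions. *)
Require Import Defs.
From HB Require Import structures.
From mathcomp Require Import all_boot all_order all_algebra.
From mathcomp Require Import all_classical all_reals all_analysis.
From mathcomp Require Import ring lra zify.
Import Order.TTheory GRing.Theory Num.Theory.
Local Open Scope classical_set_scope.
Local Open Scope ring_scope.

Lemma ler_ln_int (R : realType) (a b : int) :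
  0 < a -> a <= b -> ln (a%:~R : R) <= ln b%:~R.
Proof.
move=> a0 ab; rewrite ler_ln ?ler_int // posrE ltr0z //.
exact: lt_le_trans ab.
Qed.

Lemma ln_int_ge0 (R : realType) (a : int) : 0 < a -> 0 <= ln (a%:~R : R).
Proof. by move=> a0; rewrite ln_ge0 // -[1](mulr1z 1) ler_int. Qed.

Lemma lnX_int (R : realType) (a : int) (n : nat) :
  0 < a -> ln ((a ^+ n)%:~R : R) = n%:R * ln a%:~R.
Proof. by move=> a0; rewrite rmorphXn lnXn ?ltr0z // mulr_natl. Qed.

Lemma lnM_int (R : realType) (a b : int) :
  0 < a -> 0 < b -> ln ((a * b)%:~R : R) = ln a%:~R + ln b%:~R.
Proof. by move=> a0 b0; rewrite rmorphM lnM // posrE ltr0z. Qed.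

(** Since [k] equals [y ^+ 2 - x ^+ 3], a solution is determined by [x] and [y], and both are
    naturals at most [expR B]. This set collects the exceptions in both directions. *)
Lemma finite_solutions_ln_le (R : realType) (B : R) :
  finite_set [set s | solutions s /\
    (ln s.1.1%:~R <= B /\ ln s.1.2%:~R <= B)].
Proof.
pose N := (Num.truncn (expR B)).+1.
pose f (p : nat * nat) : int * int * int :=
  (p.1%:Z, p.2%:Z, p.2%:Z ^+ 2 - p.1%:Z ^+ 3).
have ltN (a : int) : 1 <= a -> ln (a%:~R : R) <= B ->
    exists2 n : nat, (n < N)%N & a = n%:Z.
  case: a => // n n1 nB; exists n => //.
  have n0 : 0 < (n%:Z%:~R : R) by rewrite ltr0z; lia.
  rewrite -(ltr_nat R); apply: le_lt_trans (truncnS_gt _).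
  by rewrite -[leLHS](lnK (x := n%:R)) ?posrE // ler_expR.
apply: (sub_finite_set (B := f @` (`I_N `*` `I_N))); last first.
  by apply: finite_image; apply: finite_setX; exact: finite_II.
move=> [[x y] k] [[e x1 y1 k0]] /= [/(ltN _ x1)[i iN xi] /(ltN _ y1)[j jN yj]].
exists (i, j) => //; rewrite /f /= -xi -yj; congr (_, _, _).
by rewrite e addrC addKr.
Qed.

Lemma le_double_of_diff (a b k : int) : b = a + k -> `|k| <= a -> b <= 2 * a.
Proof. lia. Qed.

(** Meant for [a = x ^+ 3] and [b = y ^+ 2]: in the unbalanced cases [k] has at least half the size
    of the larger term. *)
Lemma diff_ge_half (a b k : int) : b = a + k ->
  (0 < a -> 2 * a < b -> b <= 2 * `|k| /\ a <= b) /\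
  (0 < b -> 2 * b < a -> a <= 2 * `|k| /\ b <= a).
Proof. lia. Qed.

Lemma solution_gt0 (x y k : int) :
  solutions (x, y, k) -> [/\ 0 < x, 0 < y & 0 < `|k|].
Proof. by case=> _ x1 y1 k0; split; lia. Qed.

Lemma ln_Pval (R : realType) (x y k : int) : solutions (x, y, k) ->
  ln ((Pval (x, y, k))%:~R : R) = ln x%:~R + ln y%:~R + ln `|k|%:~R.
Proof.
move=> /solution_gt0 [x0 y0 k0].
by rewrite /Pval !lnM_int // mulr_gt0.
Qed.

Lemma ln_Mval (R : realType) (x y k : int) : solutions (x, y, k) ->
  ln ((Mval (x, y, k))%:~R : R) = Num.max (3 * ln x%:~R) (2 * ln y%:~R).
Proof.
move=> /solution_gt0 [x0 y0 k0]; rewrite /Mval -!lnX_int //.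
have [h|/ltW h] := leP (x ^+ 3) (y ^+ 2).
  by rewrite (max_idPr _) // ler_ln_int // exprn_gt0.
by rewrite (max_idPl _) // ler_ln_int // exprn_gt0.
Qed.

Lemma ln_half_cube_le (R : realType) (a b : int) :
  0 < a -> 0 < b -> a ^+ 3 <= 2 * b ^+ 2 ->
  3 * ln (a%:~R : R) <= ln 2 + 2 * ln b%:~R.
Proof.
move=> a0 b0 /(@ler_ln_int R) -/(_ (exprn_gt0 _ a0)).
by rewrite lnM_int ?exprn_gt0 // !lnX_int.
Qed.

Lemma ln_square_le (R : realType) (a b : int) :
  0 < a -> 0 < b -> b ^+ 2 <= 2 * a ^+ 3 ->
  2 * ln (b%:~R : R) <= ln 2 + 3 * ln a%:~R.
Proof.
move=> a0 b0 /(@ler_ln_int R) -/(_ (exprn_gt0 _ b0)).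
by rewrite lnM_int ?exprn_gt0 // !lnX_int.
Qed.

Lemma small_k_lnP (R : realType) (S : set (int * int * int)) (e : R)
    (x y k : int) : S `<=` solutions -> S (x, y, k) ->
  small_k S e (x, y, k) <-> ln (`|k|%:~R : R) < e * ln x%:~R.
Proof.
move=> hS Ss; have [x0 _ k0] := solution_gt0 _ _ _ (hS _ Ss).
rewrite /small_k /= -ln_powR ltr_ln ?posrE ?ltr0z ?powR_gt0 ?ltr0z //.
by split=> [[]|].
Qed.

(* For [c < 0] the junk value [a / 0 = 0] would break the equivalence. *)
Lemma large_gain_lnP (R : realType) (S : set (int * int * int)) (c : R)
    (x y k : int) : 0 < c -> S `<=` solutions -> S (x, y, k) ->
  large_gain S c (x, y, k) <->
  0 < ln (x%:~R : R) + ln y%:~R + ln `|k|%:~R /\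
  c * (ln (x%:~R : R) + ln y%:~R + ln `|k|%:~R) <
    Num.max (3 * ln x%:~R) (2 * ln y%:~R).
Proof.
move=> c0 hS Ss; have hs := hS _ Ss; have [x0 y0 k0] := solution_gt0 _ _ _ hs.
rewrite /large_gain /= /approx_gain ln_Pval // ln_Mval //.
set P := _ + _ + _.
have : 0 <= P by rewrite !addr_ge0 ?ln_int_ge0.
rewrite le_eqVlt => /predU1P[<-|P0].
  by rewrite invr0 mulr0 ltxx; split=> -[] // _; rewrite ltNge ltW.
by rewrite ltr_pdivlMr //=; split=> -[].
Qed.

Lemma gain_of_small_k (R : realType) (S : set (int * int * int))
    (kappa delta : R) : S `<=` solutions ->
  6 / 11 <= kappa < 6 / 5 -> 0 < delta < gamma kappa ->
  exists2 eps, 0 < eps & exists B : R, small_k S (gamma kappa - delta) `<=`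
    large_gain S (kappa + eps) `|`
    [set s | solutions s /\ (ln s.1.1%:~R <= B /\ ln s.1.2%:~R <= B)].
Proof.
move=> hS hk; rewrite /gamma.
have k0 : 0 < kappa by lra.
set t := 3 / kappa => hd.
have kt : kappa * t = 3 by rewrite /t mulrC divfK // gt_eqF.
(* The bound [6 / 11 <= kappa] enters here: it makes the exponent [t - 5 / 2 - delta] less than 3,
   whence [|k| <= x ^+ 3] below. *)
have t6 : t <= 11 / 2 by nra.
(* Chosen so that [eps * t] is half of [kappa * delta]. The other half, times [ln x], absorbs the
   [ln 2] error as soon as [ln x] exceeds [B0]. *)
pose eps := kappa ^+ 2 * delta / 6.
have e0 : 0 < eps by rewrite /eps !mulr_gt0 ?exprn_gt0 //; lra.
have et : eps * t = kappa * delta / 2.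
  have -> : eps * t = kappa * t * (kappa * delta / 6) by rewrite /eps; ring.
  by rewrite kt; lra.
have L0 : 0 <= ln (2 : R) by rewrite ln_ge0 // ler1n.
exists eps => //.
pose B0 := (kappa + eps) * ln 2 / (kappa * delta).
have kd : 0 < kappa * delta by rewrite mulr_gt0 //; lra.
have B0E : B0 * (kappa * delta) = (kappa + eps) * ln 2.
  by rewrite /B0 divfK // gt_eqF.
have B00 : 0 <= B0 by rewrite divr_ge0 ?mulr_ge0 //; lra.
exists (3 / 2 * B0 + ln 2) => -[[x y] k] sk.
have Ss : S (x, y, k) by case: sk.
have hs := hS _ Ss; have [x0 y0 ak0] := solution_gt0 _ _ _ hs.
move: sk; rewrite small_k_lnP // => Kg.
have X0 := ln_int_ge0 R _ x0.
have Y0 := ln_int_ge0 R _ y0.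
have K0 := ln_int_ge0 R _ ak0.
have kx : `|k| <= x ^+ 3.
  rewrite -(ler_int R) -ler_ln ?posrE ?ltr0z ?exprn_gt0 //.
  by rewrite lnX_int //; nra.
have hE : y ^+ 2 = x ^+ 3 + k by case: hs.
have yx := le_double_of_diff _ _ _ hE kx.
have Yle := ln_square_le R _ _ x0 y0 yx.
have [Xle|Xgt] := leP (ln (x%:~R : R)) B0; [right|left].
  by split=> //=; split; lra.
rewrite large_gain_lnP //; last lra.
split.
  have : 0 < ln (x%:~R : R) by lra.
  lra.
rewrite lt_max; apply/orP; left.
move: Kg Xgt X0 Y0 K0 Yle.
set X := ln x%:~R; set Y := ln y%:~R; set K := ln `|k|%:~R => Kg Xgt X0 Y0 K0 Yle.
(* Here [Y <= 3 / 2 * X + ln 2 / 2] cancels the [5 / 2] in [gamma kappa]. *)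
have PX : X + Y + K < (t - delta) * X + ln 2 / 2 by lra.
apply: (@lt_le_trans _ _ ((kappa + eps) * ((t - delta) * X + ln 2 / 2))).
  by rewrite ltr_pM2l //; lra.
have h1 : B0 * (kappa * delta) <= X * (kappa * delta) by rewrite ler_pM2r // ltW.
have h2 : 0 <= eps * delta * X by rewrite !mulr_ge0 //; lra.
have -> : (kappa + eps) * ((t - delta) * X + ln 2 / 2) =
  (kappa * t + eps * t - kappa * delta) * X - eps * delta * X
  + (kappa + eps) * ln 2 / 2 by ring.
rewrite kt et -B0E; lra.
Qed.

Lemma small_k_of_gain (R : realType) (S : set (int * int * int))
    (c d : R) : S `<=` solutions -> 3 / 4 < c -> gamma c < d ->
  exists B : R, large_gain S c `<=` small_k S d `|`
    [set s | solutions s /\ (ln s.1.1%:~R <= B /\ ln s.1.2%:~R <= B)].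
Proof.
move=> hS hc; rewrite /gamma.
have c0 : 0 < c by lra.
set t := 3 / c => hd.
have ct : c * t = 3 by rewrite /t mulrC divfK // gt_eqF.
have t0 : 0 < t by rewrite divr_gt0.
have L0 : 0 <= ln (2 : R) by rewrite ln_ge0 // ler1n.
(* [B1] bounds [ln y] when [2 * x ^+ 3 < y ^+ 2], and [B2] bounds [ln x] when [2 * y ^+ 2 < x ^+ 3];
   the denominator of [B2] is positive because [3 / 4 < c]. In the balanced case, [B3] is the value
   of [ln x] beyond which the gap [d - gamma c] absorbs the error. *)
pose B1 := c * ln 2 / (3 * c - 2).
pose B2 := c * ln 2 / (4 * c - 3).
pose B3 := (t / 3 + 1 / 2) * ln 2 / (d - (t - 5 / 2)).
have B1E : B1 * (3 * c - 2) = c * ln 2 by rewrite /B1 divfK // gt_eqF //; lra.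
have B2E : B2 * (4 * c - 3) = c * ln 2 by rewrite /B2 divfK // gt_eqF //; lra.
have B3E : B3 * (d - (t - 5 / 2)) = (t / 3 + 1 / 2) * ln 2.
  by rewrite /B3 divfK // gt_eqF //; lra.
have B10 : 0 <= B1 by rewrite divr_ge0 ?mulr_ge0 //; lra.
have B20 : 0 <= B2 by rewrite divr_ge0 ?mulr_ge0 //; lra.
have B30 : 0 <= B3 by rewrite divr_ge0 ?mulr_ge0 //; lra.
(* In each exceptional case one of [ln x], [ln y] is bounded directly; the other follows from
   comparing [x ^+ 3] with [y ^+ 2], at the cost of a factor at most [3 / 2] and a term at most
   [ln 2]. *)
exists (3 / 2 * (B1 + B2 + B3) + ln 2) => -[[x y] k] sk.
have Ss : S (x, y, k) by case: sk.
have hs := hS _ Ss; have [x0 y0 ak0] := solution_gt0 _ _ _ hs.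
move: sk; rewrite large_gain_lnP // => -[_ Pc].
have X0 := ln_int_ge0 R _ x0.
have Y0 := ln_int_ge0 R _ y0.
have K0 := ln_int_ge0 R _ ak0.
have hE : y ^+ 2 = x ^+ 3 + k by case: hs.
have [x3 y2] := (exprn_gt0 3 x0, exprn_gt0 2 y0).
have [far_y far_x] := diff_ge_half _ _ _ hE.
have [yx|yx] := leP (y ^+ 2) (2 * x ^+ 3); last first.
  have [/(ler_ln_int R _ _ y2) + /(ler_ln_int R _ _ x3)] := far_y x3 yx.
  rewrite !lnX_int // lnM_int // => YK XY.
  right; split=> //=; move: Pc; rewrite (max_idPr _) //.
  move: XY YK X0 Y0 K0.
  set X := ln x%:~R; set Y := ln y%:~R; set K := ln `|k|%:~R => XY YK X0 Y0 K0 Pc.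
  have h : c * (3 * Y - ln 2) <= c * (X + Y + K) by rewrite ler_pM2l //; lra.
  have : Y <= B1 by rewrite -(@ler_pM2r _ (3 * c - 2)) ?B1E; lra.
  by lra.
have [xy|xy] := leP (x ^+ 3) (2 * y ^+ 2); last first.
  have [/(ler_ln_int R _ _ x3) + /(ler_ln_int R _ _ y2)] := far_x y2 xy.
  rewrite !lnX_int // lnM_int // => XK YX.
  right; split=> //=; move: Pc; rewrite (max_idPl _) //.
  move: YX XK X0 Y0 K0.
  set X := ln x%:~R; set Y := ln y%:~R; set K := ln `|k|%:~R => YX XK X0 Y0 K0 Pc.
  have h : c * (4 * X - ln 2) <= c * (X + Y + K) by rewrite ler_pM2l //; lra.
  have : X <= B2 by rewrite -(@ler_pM2r _ (4 * c - 3)) ?B2E; lra.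
  by lra.
have YX := ln_square_le R _ _ x0 y0 yx.
have XY := ln_half_cube_le R _ _ x0 y0 xy.
have [Xle|Xgt] := leP (ln (x%:~R : R)) B3; [right|left].
  by split=> //=; split; lra.
rewrite small_k_lnP //.
move: Pc YX XY Xgt X0 Y0 K0.
set X := ln x%:~R; set Y := ln y%:~R; set K := ln `|k|%:~R.
move=> Pc YX XY Xgt X0 Y0 K0.
(* By balance, [ln M] is at most [3 * X + ln 2], written here as a multiple of [c] through
   [c * t = 3]. *)
have {}Pc : c * (X + Y + K) < c * (t * X + t / 3 * ln 2).
  apply: lt_le_trans Pc _.
  have -> : c * (t * X + t / 3 * ln 2) = c * t * X + c * t * (ln 2 / 3) by ring.
  by rewrite ct ge_max; lra.
rewrite ltr_pM2l // in Pc.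
have h : B3 * (d - (t - 5 / 2)) <= X * (d - (t - 5 / 2)).
  by rewrite ler_pM2r ?ltW //; lra.
rewrite B3E in h; lra.
Qed.

Lemma ltr_gamma (R : realType) (a b : R) : 0 < a -> a < b -> gamma b < gamma a.
Proof.
by move=> a0 ab; rewrite ltrD2r ltr_pM2l // ltf_pV2 ?posrE // (lt_trans a0).
Qed.

Lemma gamma_gt0 (R : realType) (a : R) : 0 < a -> a < 6 / 5 -> 0 < gamma a.
Proof.
by move=> a0 /(ltr_gamma _ _ _ a0); apply: le_lt_trans; rewrite /gamma; lra.
Qed.

Theorem proposition3p2 (R : realType) (S : set (int * int * int))
    (hS : S `<=` solutions) :
  (forall kappa : R, 6 / 11 <= kappa < 6 / 5 ->
     (forall eps : R, 0 < eps -> finite_set (large_gain S (kappa + eps))) ->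
     forall delta : R, 0 < delta < gamma kappa ->
       finite_set (small_k S (gamma kappa - delta)))
  /\
  (forall kappa : R, 3 / 4 <= kappa < 6 / 5 ->
     (forall delta : R, 0 < delta < gamma kappa ->
        finite_set (small_k S (gamma kappa - delta))) ->
     forall eps : R, 0 < eps -> finite_set (large_gain S (kappa + eps))).
Proof.
split=> kappa hk fin.
  move=> delta hd; have [eps e0 [B sub]] := gain_of_small_k _ _ _ _ hS hk hd.
  apply: sub_finite_set sub _; rewrite finite_setU; split; first exact: fin.
  exact: finite_solutions_ln_le.
move=> eps e0.
(* Lowering the threshold to [c] only enlarges the set of large gains. As [gamma] decreases and
   vanishes at [6 / 5], [c < 6 / 5] keeps [gamma c] positive, so half the gap
   [gamma kappa - gamma c] is an admissible [delta]. *)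
have [c kc [cle c65]] : exists2 c, kappa < c & c <= kappa + eps /\ c < 6 / 5.
  have [le|lt] := leP (kappa + eps) ((kappa + 6 / 5) / 2).
    by exists (kappa + eps); [lra|split=> //; lra].
  by exists ((kappa + 6 / 5) / 2); [lra|split; lra].
have k0 : 0 < kappa by lra.
have gc0 : 0 < gamma c by apply: gamma_gt0; lra.
have gck := ltr_gamma _ _ _ k0 kc.
have c34 : 3 / 4 < c by lra.
have [B sub] :=
  small_k_of_gain _ _ c (gamma kappa - (gamma kappa - gamma c) / 2)
    hS c34 ltac:(lra).
apply: (sub_finite_set (B := large_gain S c)).
  by move=> s [Ss /(le_lt_trans cle)].
apply: sub_finite_set sub _; rewrite finite_setU; split.
  by apply: fin; lra.
exact: finite_solutions_ln_le.
Qed.
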